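(* Let $(L,\tau)$ be a Hausdorff locally solid Riesz space, let $\mathcal{I}$ be an admissible ideal of $\mathbb{N}$, let $t=\{t_n\}_{n\in\mathbb{N}}$ be a weighted sequence, and let $V\in\mathcal{N}_{sol}$ be such that $V+U\in\mathcal{N}_{sol}$ for all $U\in\mathcal{N}_{sol}$. If $x=\{x_n\}_{n\in\mathbb{N}}$ is a sequence in $L$, then $$x_*-c\in\frac{\overline{V}}{\inf_{n\in\mathbb{N}}t_n}\quad\text{for all }x_*\in W\mathcal{I}_\tau\text{-}LIM^{V}x\text{ and }c\in W_{\mathcal{I}}\Gamma_x^\tau.$$ Moreover, if $V$ is $\tau$-bounded, $V+V+U\in\mathcal{N}_{sol}$ for all $U\in\mathcal{N}_{sol}$, and $W\mathcal{I}_\tau\text{-}LIM^{V}x$ is non-empty, then $W_{\mathcal{I}}\Gamma_x^\tau$ is $\tau$-bounded.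
   Context: A Riesz space is a real ordered vector space that is a lattice under its order; $|x|=x\vee(-x)$. A subset $S$ of a Riesz space is solid if $y\in S$ and $|x|\le|y|$ imply $x\in S$. A locally solid Riesz space $(L,\tau)$ is a Riesz space $L$ with a linear topology $\tau$ (addition and scalar multiplication are continuous) having a base of neighborhoods at the zero element $\theta$ consisting of solid sets. $\mathcal{N}_{sol}$ denotes a (fixed) base of neighborhoods at $\theta$ consisting of solid sets such that: (a) each $W\in\mathcal{N}_{sol}$ is balanced ($\lambda x\in W$ for $x\in W$, $|\lambda|\le1$); (b) each $W\in\mathcal{N}_{sol}$ is absorbing (for every $x\in L$ there is $\lambda>0$ with $\lambda x\in W$); (c) for each $W\in\mathcal{N}_{sol}$ there is $W'\in\mathcal{N}_{sol}$ with $W'+W'\subseteq W$. An admissible ideal $\mathcal{I}$ of $\mathbb{N}$ is a proper ideal of subsets of $\mathbb{N}$ (closed under subsets and finite unions, $\mathbb{N}\notin\mathcal{I}$) containing all singletons. A weighted sequence is a sequence $\{t_n\}_{n\in\mathbb{N}}$ of real numbers for which there is a real $\delta>0$ with $t_n>\delta$ for all $n$. A subset $A\subseteq L$ is $\tau$-bounded if for every neighborhood $U$ of $\theta$ there is $\lambda>0$ with $A\subset\lambda U$. Overline denotes $\tau$-closure, and for $S\subseteq L$ and $a>0$, $\frac{S}{a}=\{a^{-1}s:s\in S\}$. For a $\tau$-neighborhood $V$ of $\theta$, the sequence $x=\{x_n\}$ is rough weighted $\mathcal{I}_\tau$-convergent to $x_*\in L$ with degree of roughness $V$ if for every $\tau$-neighborhood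 $U$ of $\theta$, $\{n\in\mathbb{N}: t_n(x_n-x_* )\notin V+U\}\in\mathcal{I}$. The set of all such $x_*\in L$ is denoted $W\mathcal{I}_\tau\text{-}LIM^{V}x$. An element $c\in L$ is a weighted $\mathcal{I}_\tau$-cluster point of $x=\{x_n\}$ if for every $\tau$-neighborhood $U$ of $\theta$, $\{n\in\mathbb{N}: t_n(x_n-c)\in U\}\notin\mathcal{I}$. The set of all weighted $\mathcal{I}_\tau$-cluster points of $x$ is denoted $W_{\mathcal{I}}\Gamma_x^\tau$. *)

(* Defs.v *)
From HB Require Import structures.
From mathcomp Require Import all_boot all_order all_algebra.
From mathcomp Require Import all_classical all_reals all_analysis.

Set Implicit Arguments.
Unset Strict Implicit.
Unset Printing Implicit Defensive.

Import Order.TTheory GRing.Theory Num.Theory.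
Import numFieldNormedType.Exports.

Local Open Scope classical_set_scope.
Local Open Scope ring_scope.

(* Order.Lattice cannot be joined with GRing.Lmodule here: Hierarchy Builder
   requires that join to be declared before Num.RealDomain.  The lattice
   operations are therefore fields, specified as in the mixins of
   Order.MeetSemilattice and Order.JoinSemilattice. *)
HB.mixin Record POrderedLmodule_isRiesz (R : realType) L
    & Num.POrderedZmodule L & GRing.Lmodule R L := {
  riesz_leD2r : forall x y z : L, x <= y -> x + z <= y + z ;
  riesz_leZ2l : forall (a : R) (x y : L), 0 <= a -> x <= y -> a *: x <= a *: y ;
  riesz_meet : L -> L -> L ;
  riesz_join : L -> L -> L ;
  riesz_lexI : forall x y z : L, (x <= riesz_meet y z) = (x <= y) && (x <= z) ;
  riesz_leUx : forall x y z : L, (riesz_join x y <= z) = (x <= z) && (y <= z)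
}.

#[short(type="rieszSpaceType")]
HB.structure Definition RieszSpace (R : realType) :=
  {L of Num.POrderedZmodule L & GRing.Lmodule R L
        & POrderedLmodule_isRiesz R L}.

Definition riesz_abs (R : realType) (L : rieszSpaceType R) (x : L) : L :=
  riesz_join x (- x).

Definition solid (R : realType) (L : rieszSpaceType R) (S : set L) : Prop :=
  forall x y : L, S y -> riesz_abs x <= riesz_abs y -> S x.

Definition nbhs0_base (R : realType) (L : preTopologicalLmodType R)
    (B : set_system L) : Prop :=
  (forall W, B W -> nbhs (0 : L) W) /\
  (forall U, nbhs (0 : L) U -> exists2 W, B W & W `<=` U).

#[short(type="topologicalRieszSpaceType")]
HB.structure Definition TopologicalRieszSpace (R : realType) :=
  {L of RieszSpace R L & TopologicalLmodule R L}.

HB.mixin Record TopologicalRiesz_isLocallySolid (R : realType) L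
    & TopologicalRieszSpace R L := {
  locally_solid : exists2 B : set_system L,
    nbhs0_base B & forall S, B S -> solid S
}.

#[short(type="locallySolidRieszType")]
HB.structure Definition LocallySolidRiesz (R : realType) :=
  {L of TopologicalRieszSpace R L & TopologicalRiesz_isLocallySolid R L}.

Definition sumset (L : zmodType) (A B : set L) : set L :=
  [set a + b | a in A & b in B].

Definition scaleset (R : realType) (L : lmodType R) (a : R) (A : set L) :
  set L := [set a *: s | s in A].

Definition balanced (R : realType) (L : lmodType R) (W : set L) : Prop :=
  forall (a : R) (x : L), W x -> `|a| <= 1 -> W (a *: x).

Definition absorbing (R : realType) (L : lmodType R) (W : set L) : Prop :=
  forall x : L, exists2 a : R, 0 < a & W (a *: x).

Record is_Nsol (R : realType) (L : locallySolidRieszType R)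
    (Nsol : set_system L) : Prop := {
  Nsol_base : nbhs0_base Nsol ;
  Nsol_solid : forall W, Nsol W -> solid W ;
  Nsol_balanced : forall W, Nsol W -> balanced W ;
  Nsol_absorbing : forall W, Nsol W -> absorbing W ;
  Nsol_half : forall W, Nsol W ->
    exists2 W', Nsol W' & sumset W' W' `<=` W
}.

Record admissible_ideal (I : set_system nat) : Prop := {
  ideal_sub : forall A B : set nat, A `<=` B -> I B -> I A ;
  ideal_setU : forall A B : set nat, I A -> I B -> I (A `|` B) ;
  ideal_proper : ~ I [set: nat] ;
  ideal_set1 : forall n : nat, I [set n]
}.

Definition weighted_sequence (R : realType) (t : nat -> R) : Prop :=
  exists2 delta : R, 0 < delta & forall n, delta < t n.

Definition tau_bounded (R : realType) (L : preTopologicalLmodType R)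
    (A : set L) : Prop :=
  forall U, nbhs (0 : L) U -> exists2 a : R, 0 < a & A `<=` scaleset a U.

Definition rough_weighted_LIM (R : realType) (L : preTopologicalLmodType R)
    (I : set_system nat) (t : nat -> R) (V : set L) (x : nat -> L) : set L :=
  [set xs | forall U, nbhs (0 : L) U ->
     I [set n | ~ sumset V U (t n *: (x n - xs))]].

Definition weighted_cluster (R : realType) (L : preTopologicalLmodType R)
    (I : set_system nat) (t : nat -> R) (x : nat -> L) : set L :=
  [set c | forall U, nbhs (0 : L) U ->
     ~ I [set n | U (t n *: (x n - c))]].

(* Main.v *)
Require Import Defs.
From mathcomp Require Import all_boot all_order all_algebra.
From mathcomp Require Import all_classical all_reals all_analysis.
Import Order.TTheory GRing.Theory Num.Theory.
Import numFieldNormedType.Exports.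
Local Open Scope classical_set_scope.
Local Open Scope ring_scope.

(** Write m for the infimum of the weights, which is positive. Let xs be a
    rough limit and c a cluster point. Given a small balanced neighborhood W of
    0, the indices n with t_n (x_n - xs) outside V + W form a set of the ideal,
    whereas those with t_n (x_n - c) in W do not. A set outside an ideal is not
    contained in a member of it, so some index n satisfies both memberships,
    and subtracting them puts t_n (xs - c) in W - (V + W). As V and W are
    balanced and 0 <= m / t_n <= 1, rescaling by m / t_n puts m (xs - c) in
    V + W + W. Since W is arbitrary, m (xs - c) lies in the closure of V: this
    is [rough_LIM_cluster_closure].

    Consequently a single rough limit xs confines the whole cluster set to the
    translate xs - m^-1 closure V. Bounded sets are stable under closure,
    scaling and sums, and points are bounded because neighborhoods are
    absorbing; so the cluster set is bounded as soon as V is. *)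

(** * Closure and boundedness through a base of balanced neighborhoods *)

(** Translating by -p turns neighborhoods of p into neighborhoods of 0, so the
    base at 0 suffices to test adherence at any point. *)
Lemma closure_nbhs0_baseP {R : realType} {L : topologicalLmodType R}
    {B : set_system L} (BP : nbhs0_base B) (A : set L) (p : L) :
  closure A p <-> forall W, B W -> exists2 a, A a & W (a - p).
Proof.
case: BP => Bnbhs Bsub; split.
- move=> clA W /Bnbhs/(nbhsB_subproof (@add_continuous L) p).
  rewrite addr0 => /clA [a [Aa [w Ww waE]]].
  by exists a => //; rewrite -waE addrC addKr.
- move=> nearA N /(nbhsB_subproof (@add_continuous L) (- p)).
  rewrite addNr => /Bsub [W BW WN]; have [a Aa /WN [b Nb baE]] := nearA _ BW.
  exists a; split=> //; suff -> : a = b by [].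
  by apply: (addrI (- p)); rewrite baE addrC.
Qed.

Lemma tau_bounded_nbhs0_baseP {R : realType} {L : preTopologicalLmodType R}
    {B : set_system L} (BP : nbhs0_base B) (A : set L) :
  tau_bounded A <->
  forall W, B W -> exists2 a : R, 0 < a & A `<=` scaleset a W.
Proof.
case: BP => Bnbhs Bsub; split=> [bA W /Bnbhs/bA //|bA U /Bsub [W BW WU]].
have [a a0 AW] := bA _ BW; exists a => // y /AW [w Ww <-].
by exists w => //; exact: WU.
Qed.

Lemma balanced_scaleset {R : realType} {L : lmodType R} {W : set L}
    (balW : balanced W) {a b : R} :
  0 < b -> `|a| <= b -> scaleset a W `<=` scaleset b W.
Proof.
move=> b0 ab _ [w Ww <-]; exists ((a / b) *: w).
  by apply: balW => //; rewrite normrM normfV (gtr0_norm b0) ler_pdivrMr ?mul1r.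
by rewrite scalerA mulrC divfK // gt_eqF.
Qed.

Lemma balancedN {R : realType} {L : lmodType R} {W : set L} {y : L} :
  balanced W -> W y -> W (- y).
Proof. by move=> balW Wy; rewrite -scaleN1r; apply: balW; rewrite ?normrN1. Qed.

Lemma tau_bounded_set1 {R : realType} {L : locallySolidRieszType R}
    {Nsol : set_system L} (NsolP : is_Nsol Nsol) (y : L) :
  tau_bounded [set y].
Proof.
apply/(tau_bounded_nbhs0_baseP (Nsol_base NsolP)) => W NW.
have [a a0 Wy] := Nsol_absorbing NsolP NW y.
exists a^-1; first by rewrite invr_gt0.
by move=> _ ->; exists (a *: y) => //; rewrite scalerK // gt_eqF.
Qed.

Lemma tau_boundedZ {R : realType} {L : locallySolidRieszType R}
    {Nsol : set_system L} (NsolP : is_Nsol Nsol) (r : R) {A : set L} :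
  tau_bounded A -> tau_bounded (scaleset r A).
Proof.
move=> bA; apply/(tau_bounded_nbhs0_baseP (Nsol_base NsolP)) => W NW.
have [a a0 AW] := bA _ ((Nsol_base NsolP).1 _ NW).
have ra0 : 0 < `|r * a| + 1 by rewrite ltr_wpDl.
exists (`|r * a| + 1) => // _ [_ /AW [w Ww <-] <-]; rewrite scalerA.
apply: (balanced_scaleset (Nsol_balanced NsolP NW) ra0 (a := r * a)).
  by rewrite lerDl.
by exists w.
Qed.

Lemma tau_boundedD {R : realType} {L : locallySolidRieszType R}
    {Nsol : set_system L} (NsolP : is_Nsol Nsol) {A B : set L} :
  tau_bounded A -> tau_bounded B -> tau_bounded (sumset A B).
Proof.
move=> bA bB; apply/(tau_bounded_nbhs0_baseP (Nsol_base NsolP)) => W NW.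
have [W' NW' W'W] := Nsol_half NsolP NW.
have [a a0 AW] := bA _ ((Nsol_base NsolP).1 _ NW').
have [b b0 BW] := bB _ ((Nsol_base NsolP).1 _ NW').
have ab0 : 0 < a + b by rewrite addr_gt0.
have scaleW' := balanced_scaleset (Nsol_balanced NsolP NW') ab0.
exists (a + b) => // _ [y /AW Ay] [z /BW Bz] <-.
have /scaleW' := Ay; rewrite gtr0_norm // lerDl ltW // => /(_ isT) [u Wu <-].
have /scaleW' := Bz; rewrite gtr0_norm // lerDr ltW // => /(_ isT) [v Wv <-].
exists (u + v); last by rewrite scalerDr.
by apply: W'W; exists u => //; exists v.
Qed.

(** For a balanced W contained in half of a neighborhood, closure A lies in
    A + W, which the neighborhood absorbs when W absorbs A. *)
Lemma tau_bounded_closure {R : realType} {L : locallySolidRieszType R}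
    {Nsol : set_system L} (NsolP : is_Nsol Nsol) {A : set L} :
  tau_bounded A -> tau_bounded (closure A).
Proof.
move=> bA; apply/(tau_bounded_nbhs0_baseP (Nsol_base NsolP)) => W NW.
have [W' NW' W'W] := Nsol_half NsolP NW.
have balW' := Nsol_balanced NsolP NW'.
have [a a0 AW] := bA _ ((Nsol_base NsolP).1 _ NW').
have a10 : 0 < a + 1 by rewrite addr_gt0.
exists (a + 1) => // p.
move=> /(closure_nbhs0_baseP (Nsol_base NsolP)) /(_ _ NW') [y Ay Wyp].
have [] : scaleset (a + 1) W' y.
  apply: (balanced_scaleset balW' a10 (a := a)); last exact: AW.
  by rewrite gtr0_norm // lerDl.
move=> u Wu uE.
have [] : scaleset (a + 1) W' (p - y).
  apply: (balanced_scaleset balW' a10 (a := 1)).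
    by rewrite normr1 lerDr ltW.
  by exists (p - y); rewrite ?scale1r // -opprB; exact: balancedN.
move=> v Wv vE; exists (u + v).
  by apply: W'W; exists u => //; exists v.
by rewrite scalerDr uE vE addrC subrK.
Qed.

(** * Rough limits against cluster points *)

Lemma ideal_not_subset {I : set_system nat} (idealI : admissible_ideal I)
    {A B : set nat} : ~ I B -> I A -> exists2 n, B n & ~ A n.
Proof.
move=> nIB IA; apply: contrapT => BA; apply: nIB.
apply: (ideal_sub idealI _ IA) => n Bn.
by apply: contrapT => nAn; apply: BA; exists n.
Qed.

(** An index that is good for both points places t_n (xs - c) in V up to a
    small error; any 0 <= m <= t_n then contracts V and the error into
    themselves. *)
Lemma rough_LIM_cluster_closure {R : realType} {L : locallySolidRieszType R}
    {Nsol : set_system L} (NsolP : is_Nsol Nsol)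
    {I : set_system nat} (idealI : admissible_ideal I)
    {t : nat -> R} {m : R} (m0 : 0 <= m) (t0 : forall n, 0 < t n)
    (mt : forall n, m <= t n)
    {V : set L} (balV : balanced V) {x : nat -> L} {xs c : L} :
  rough_weighted_LIM I t V x xs -> weighted_cluster I t x c ->
  closure V (m *: (xs - c)).
Proof.
move=> limxs clc; apply/(closure_nbhs0_baseP (Nsol_base NsolP)) => W NW.
have [W' NW' W'W] := Nsol_half NsolP NW.
have balW' := Nsol_balanced NsolP NW'.
have nW' := (Nsol_base NsolP).1 _ NW'.
have [n Wn /contrapT [v Vv [w Ww vwE]]] :=
  ideal_not_subset idealI (clc _ nW') (limxs _ nW').
have r1 : `|m / t n| <= 1.
  by rewrite ger0_norm ?ler_pdivrMr ?mul1r // divr_ge0 // ltW.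
exists ((m / t n) *: - v); first exact: balV (balancedN balV Vv) r1.
have -> : (m / t n) *: - v - m *: (xs - c)
    = (m / t n) *: w + (m / t n) *: - (t n *: (x n - c)).
  have -> : m *: (xs - c) = (m / t n) *: (t n *: (xs - c)).
    by rewrite scalerA divfK // gt_eqF.
  rewrite -scalerBr -scalerDr.
  have -> : w = t n *: (x n - xs) - v by rewrite -vwE addrC addKr.
  congr (_ *: _); rewrite [LHS]addrC [RHS]addrAC; congr (_ - v).
  rewrite -scalerBr -scalerN !opprB; congr (_ *: _).
  by rewrite [RHS]addrC addrA subrK.
apply: W'W; exists ((m / t n) *: w); first exact: balW'.
exists ((m / t n) *: - (t n *: (x n - c))) => //.
exact: balW' (balancedN balW' Wn) r1.
Qed.

Theorem theorem2p8 (R : realType) (L : locallySolidRieszType R)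
    (hausL : hausdorff_space L)
    (Nsol : set_system L) (NsolP : is_Nsol Nsol)
    (I : set_system nat) (idealI : admissible_ideal I)
    (t : nat -> R) (wt : weighted_sequence t)
    (V : set L) (NsolV : Nsol V)
    (NsolVU : forall U, Nsol U -> Nsol (sumset V U))
    (x : nat -> L) :
  (forall xs c : L,
      rough_weighted_LIM I t V x xs -> weighted_cluster I t x c ->
      scaleset (inf (range t))^-1 (closure V) (xs - c)) /\
  (tau_bounded V ->
   (forall U, Nsol U -> Nsol (sumset (sumset V V) U)) ->
   rough_weighted_LIM I t V x !=set0 ->
   tau_bounded (weighted_cluster I t x)).
Proof.
case: wt => d d0 dt; set m := inf (range t).
have lbt : lbound (range t) d by move=> _ [n _ <-]; exact: ltW.
have dm : d <= m by apply: lb_le_inf lbt; exists (t 0%N), 0%N.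
have m0 : 0 < m := lt_le_trans d0 dm.
have mt n : m <= t n by apply: ge_inf; [exists d | exists n].
have diff_closure (xs c : L) : rough_weighted_LIM I t V x xs ->
    weighted_cluster I t x c -> scaleset m^-1 (closure V) (xs - c).
  move=> limxs clc; exists (m *: (xs - c)); last by rewrite scalerK // gt_eqF.
  apply: (rough_LIM_cluster_closure NsolP idealI _ _ mt _ limxs clc) => [|n|].
  - exact: ltW.
  - exact: lt_trans (dt n).
  - exact: (Nsol_balanced NsolP NsolV).
split=> // bV _ [xs limxs].
have bcover : tau_bounded
    (sumset [set xs] (scaleset (-1) (scaleset m^-1 (closure V)))).
  apply: (tau_boundedD NsolP); first exact: (tau_bounded_set1 NsolP).
  by do 2 apply: (tau_boundedZ NsolP); exact: (tau_bounded_closure NsolP).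
move=> U /bcover [a a0 coverU]; exists a => // c clc; apply: coverU.
exists xs => //; exists (c - xs); last by rewrite addrC subrK.
by exists (xs - c); [exact: diff_closure | rewrite scaleN1r opprB].
Qed.
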